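(* For every integer $n\ge1$, let $P(n)$ denote the number of local equivalence classes of truncated profiles of length $n$. Then \[ P(n)=\prod_{k=2}^{n}\min(k,n-k+2). \] Equivalently, for integers $m\ge 1$, \[ P(n)=\begin{cases}(m!)^2, & \text{if } n=2m-1,\\ m!\,(m+1)!, & \text{if } n=2m.\end{cases} \]
   Context: A truncated profile of length $n\ge 1$ is a tuple $r=(r_2,\ldots,r_n)$ with $r_k\in\mathbb Z/k\mathbb Z$ for each $2\le k\le n$ (the empty tuple if $n=1$). For $2\le k\le n$ and $a\in\mathbb Z/k\mathbb Z$ put \[ E^{(n)}_{k,a}=\{m\in\{k+1,\ldots,n+1\}:\ m\equiv a\pmod k\}. \] Two truncated profiles $r=(r_2,\ldots,r_n)$ and $s=(s_2,\ldots,s_n)$ are locally equivalent if $E^{(n)}_{k,r_k}=E^{(n)}_{k,s_k}$ for every $2\le k\le n$. Empty products equal $1$. *)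

(* Defs.v *)
From mathcomp Require Import all_boot all_algebra.

Set Implicit Arguments.
Unset Strict Implicit.
Unset Printing Implicit Defensive.

(* Truncated profiles of length n. The index i : 'I_n.-1 stands for the
   modulus k = i + 2, so k ranges over 2 <= k <= n. Every modulus is at
   least 2, so that 'Z_k is really Z/kZ. For n = 1 the only profile is the
   empty one. *)
Notation profile n := {dffun forall i : 'I_n.-1, 'Z_(i.+2)}.

(* The bound m <= n + 1 is carried by the type 'I_n.+2. *)
Definition E (n k : nat) (a : 'Z_k) : {set 'I_n.+2} :=
  [set m : 'I_n.+2 | (k < m) && ((m : nat)%:R%R == a)].

Definition locally_equivalent (n : nat) (r s : profile n) : bool :=
  [forall i : 'I_n.-1, @E n i.+2 (r i) == @E n i.+2 (s i)].

Lemma locally_equivalent_equiv (n : nat) :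
  equivalence_rel (@locally_equivalent n).
Proof.
move=> r s t; split; first by apply/forallP=> i.
by move=> /forallP rs; apply: eq_forallb => i; rewrite (eqP (rs i)).
Qed.

Definition P (n : nat) : nat :=
  #|equivalence_partition (@locally_equivalent n) [set: profile n]|.

(* Main.v *)
Require Import Defs.
From mathcomp Require Import all_boot all_algebra.
From mathcomp Require Import zify.

(** Local equivalence compares profiles coordinate by coordinate, so its classes
    correspond to the values of the map sending a profile [r] to the family
    [(E_{k, r_k})_k]. The coordinates of [r] vary independently, so the number
    of such families is the product over [k] of the number of distinct sets
    [E_{k,a}] ([card_classes_image], [card_prod_image]).

    For fixed [k] the sets [E_{k,a}] are disjoint, being the residue classes of
    the interval [k+1..n+1], which has [n-k+1] elements. If [2k <= n+1] the
    interval contains a full residue system, so all [k] sets are nonempty and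
    distinct. Otherwise it contains at most one element of each class and no
    multiple of [k], so the sets are the [n-k+1] singletons and the empty set.
    Both counts equal [min(k, n-k+2)] ([card_E_image]).

    In the product the minimum is [k] for the lower half of the range and
    [n-k+2] for the upper half; each half multiplies to a factorial
    ([prod_minn_fact]). *)

Lemma card_classes_image (T U : finType) (f : T -> U) (R : rel T) :
    (forall x y, R x y = (f x == f y)) ->
  #|equivalence_partition R [set: T]| = #|f @: [set: T]|.
Proof.
move=> RE; pose h v := [set y in [set: T] | v == f y].
have -> : equivalence_partition R [set: T] = h @: (f @: [set: T]).
  rewrite -imset_comp; apply: eq_imset => x /=.
  by apply/setP=> y; rewrite !inE RE.
apply: card_in_imset => u v /imsetP[x _ ->] _ /setP/(_ x).
by rewrite !inE eqxx => /esym/eqP.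
Qed.

(** The image of a product map is the product of the images. *)
Lemma card_prod_image (I S : finType) (A : I -> finType)
    (g : forall i, A i -> S) :
  #|[set [ffun i => g i (r i)] | r : {dffun forall i, A i}]|
    = \prod_i #|[set g i a | a : A i]|.
Proof.
pose F i := [set g i a | a : A i].
rewrite -[RHS]/(\prod_i #|F i|).
have -> : \prod_i #|F i| = #|family (fun i => mem (F i))|.
  by rewrite card_family foldrE big_map enumT.
apply: eq_card => u; apply/imsetP/familyP => [[r _ ->] i | uF].
  by rewrite ffunE; apply: imset_f.
have ex i : exists a, u i == g i a by have /imsetP[a _ ->] := uF i; exists a.
exists [ffun i => xchoose (ex i)] => //.
by apply/ffunP=> i; rewrite !ffunE; apply/eqP/(xchooseP (ex i)).
Qed.

Lemma natr_Zp_eq (k a b : nat) :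
  ((a%:R == b%:R :> 'Z_k.+2) = (a == b %[mod k.+2]))%R.
Proof. by rewrite -val_eqE /= !val_Zp_nat. Qed.

(** The factor contributed by the modulus [k = i + 2]. *)
Lemma card_E_image (n i : nat) : i < n.-1 ->
  #|[set @E n i.+2 a | a : 'Z_i.+2]| = minn i.+2 (n - i.+2 + 2).
Proof.
move=> lt_in; set k := i.+2.
have [le_k | gt_k] := leqP (2 * k) n.+1.
  rewrite card_imset => [|a b eqE_ab]; first by rewrite card_ord; lia.
  (* Injectivity: a is recovered from any element of its class. A
     witness for the class of a is 2k when a = 0, and k + a otherwise. *)
  pose w := k + (if a == 0 :> nat then k else a).
  have lt_ak : a < k := ltn_ord a.
  have lt_w : w < n.+2 by rewrite /w; case: ifP; lia.
  have wa : (w%:R = a :> 'Z_k)%R.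
    rewrite -[RHS]natr_Zp; apply/eqP; rewrite natr_Zp_eq /w modnDl.
    by case: (nat_of_ord a =P 0) => // ->; rewrite modnn mod0n.
  have: Ordinal lt_w \in @E n k a.
    rewrite inE /= wa eqxx andbT /w; case: ifP; lia.
  by rewrite eqE_ab inE /= wa => /andP[_ /eqP].
(* The range [k+1..n+1] is shorter than k, so a class has at most one element
   there. *)
have E_single (m : 'I_n.+2) : k < m -> @E n k (m%:R)%R = [set m].
  move=> lt_km; apply/setP=> m'; rewrite !inE natr_Zp_eq.
  apply/andP/eqP => [[lt_km' /eqP e]|->]; last by [].
  apply: val_inj => /=; move: (ltn_ord m) (ltn_ord m') => ? ?.
  have {e}: m' - k = m - k %[mod k].
    by apply/eqP; rewrite -(eqn_modDl k) !subnKC ?e // ltnW.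
  by rewrite !modn_small; lia.
have E_zero : @E n k 0%R = set0.
  apply/setP=> m; rewrite !inE; apply/negP => /andP[lt_km].
  rewrite (natr_Zp_eq i m 0) mod0n => /dvdnP[q mq].
  move: (ltn_ord m); rewrite mq in lt_km *.
  by case: q {mq} lt_km => [|[|q]] *; nia.
pose B := [set m : 'I_n.+2 | k < m].
have -> : [set @E n k a | a : 'Z_k] = set0 |: (set1 @: B).
  apply/setP=> X; rewrite in_setU1; apply/imsetP/orP => [[a _ ->]|].
    have [-> | [m]] := set_0Vmem (@E n k a); first by left.
    rewrite inE => /andP[lt_km /eqP <-]; right.
    by rewrite E_single //; apply: imset_f; rewrite inE.
  case=> [/eqP-> | /imsetP[m]]; first by exists 0%R.
  by rewrite inE => lt_km ->; exists (m%:R)%R => //; rewrite E_single.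
have set0NB : set0 \notin set1 @: B.
  by apply/imsetP=> -[m _ /setP/(_ m)]; rewrite !inE eqxx.
have cardB : #|B| = n - i.+1.
  have -> : B = ~: [set m : 'I_n.+2 | m < k.+1].
    by apply/setP=> m; rewrite !inE ltnS -ltnNge.
  have le_kn : k.+1 <= n.+2 by lia.
  rewrite cardsCs setCK card_ord.
  have -> : [set m : 'I_n.+2 | m < k.+1] = widen_ord le_kn @: [set: 'I_k.+1].
    apply/setP=> m; rewrite inE; apply/idP/imsetP => [lt_mk | [j _ ->]].
      by exists (Ordinal lt_mk) => //; apply: val_inj.
    exact: (ltn_ord j).
  rewrite card_imset ?cardsT ?card_ord; last first.
    by move=> a b /(congr1 val) /= /val_inj.
  by lia.
by rewrite cardsU1 set0NB card_imset ?cardB //; [lia | apply: set1_inj].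
Qed.

Lemma P_prod_minn (n : nat) : 1 <= n ->
  P n = \prod_(2 <= k < n.+1) minn k (n - k + 2).
Proof.
move=> n_gt0; rewrite /P.
pose f (r : profile n) := [ffun i : 'I_n.-1 => @E n i.+2 (r i)].
rewrite (@card_classes_image _ _ f) => [|r s]; last first.
  apply/forallP/eqP => [rs | /ffunP rs i].
    by apply/ffunP=> i; rewrite !ffunE; apply/eqP.
  by move: (rs i); rewrite !ffunE => /eqP.
have -> : f @: [set: profile n] = [set f r | r : profile n].
  by apply/setP=> X; apply/imsetP/imsetP => -[r _ ->]; exists r.
rewrite (@card_prod_image _ _ _ (fun i : 'I_n.-1 => @E n i.+2)).
rewrite (eq_bigr _ (fun (i : 'I_n.-1) _ => @card_E_image n i (ltn_ord i))).
by rewrite -(big_mkord xpredT (fun i => minn i.+2 (n - i.+2 + 2))) !big_add1.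
Qed.

Lemma prod_rev_fact (p q : nat) :
  \prod_(p.+1 <= k < p + q.+1) (p + q.+2 - k) = (q.+1)`!.
Proof.
elim: q p => [|q IHq] p; first by rewrite addn1 big_geq.
rewrite big_ltn; last by lia.
rewrite factS -(IHq p.+1) addSnnS; congr (_ * _); first by lia.
by apply: eq_bigr => k _; lia.
Qed.

(** The parities of [n] are treated together: [p] and [q] are the halves of
    [n + 1], rounded up and down, and the minimum switches from [k] to
    [n - k + 2] after [k = p]. *)
Lemma prod_minn_fact (n p q : nat) : 0 < q -> q <= p <= q.+1 -> p + q = n.+1 ->
  \prod_(2 <= k < n.+1) minn k (n - k + 2) = p`! * q`!.
Proof.
case: q => // q _ /andP[le_qp le_pq] pqn.
rewrite (@big_cat_nat _ _ _ p.+1) /=; [|lia|lia].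
rewrite fact_prod [X in _ = X * _]big_ltn ?mul1n -?(prod_rev_fact p q) -?pqn;
  last by lia.
congr (_ * _); apply: eq_big_nat => k /andP[? ?]; lia.
Qed.

Theorem theorem4 :
  (forall n : nat, 1 <= n ->
     P n = \prod_(2 <= k < n.+1) minn k (n - k + 2)) /\
  (forall m : nat, 1 <= m ->
     P (2 * m - 1) = (m`!) ^ 2 /\ P (2 * m) = m`! * (m.+1)`!).
Proof.
split=> [|m m_gt0]; first exact: P_prod_minn.
split; rewrite P_prod_minn; try lia.
  by rewrite (@prod_minn_fact _ m m) //; lia.
by rewrite mulnC (@prod_minn_fact _ m.+1 m) 1?mulnC //; lia.
Qed.
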